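(* Let $G$ be an edge-colored graph of order $n$ with $n\geq 4$. If $\sum_{v\in V(G)} d^c(v)\geq \frac{n(n+1)}{2}+1$, then $G$ contains a properly colored $C_4$. Moreover, if $\sum_{v\in V(G)} d^c(v)=\frac{n(n+1)}{2}$ and $G$ contains no properly colored $C_4$, then $G$ is complete and has a layered structure whose center part is a rainbow triangle.
   Context: Graphs are finite and simple. An edge-colored graph is a graph with an arbitrary assignment of a color to each edge (not necessarily proper). For a vertex $v$, the color degree $d^c(v)$ is the number of distinct colors appearing on edges incident to $v$. A subgraph is rainbow if all its edges have distinct colors, and properly colored if any two of its adjacent edges have distinct colors. $C_4$ is the cycle on 4 vertices, as a (not necessarily induced) subgraph. Layered structure and center part: an edge-colored complete graph $K$ on $m$ vertices using exactly $m$ colors has a layered structure if (recursively) one of the following holds: (1) there is a vertex $v$ all of whose incident edges have a single color, and $K-v$ is an edge-colored complete graph on $m-1$ vertices using exactly $m-1$ colors that has a layered structure; the center part of $K$ is then that of $K-v$; (2) there is a rainbow triangle $uvw$ with, say, $uv$ red, $vw$ blue and $uw$ green, such that all other edges incident to $u$ are red, all other edges incident to $v$ are blue, all other edges incident to $w$ are green, and $K-\{u,v,w\}$ is an edge-colored complete graph on $m-3$ vertices using exactly $m-3$ colors that has a layered structure; the center part of $K$ is then that of $K-\{u,v,w\}$; (3) there is a vertex $v$ whose incident edges all have pairwise distinct colors, while all other edges of $K$ have one single color, distinct from the colors of the edges incident to $v$; the center part of $K$ is then $K$ itself. The center part is a rainbow triangle when this final complete graph of type (3) has exactly three vertices. 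*)

(* Defs.v *)
From HB Require Import structures.
From mathcomp Require Import all_boot.

Set Implicit Arguments.
Unset Strict Implicit.
Unset Printing Implicit Defensive.

(* [col u v] is the color of the edge uv; it is meaningful only when
   [adj u v] holds, and nothing below depends on its other values. *)
Record ecgraph (V : finType) (C : eqType) := ECGraph {
  adj : rel V;
  col : V -> V -> C;
  adj_sym : symmetric adj;
  adj_irr : irreflexive adj;
  col_sym : forall u v, adj u v -> col u v = col v u
}.

Section EdgeColored.
Variables (V : finType) (C : eqType) (G : ecgraph V C).
Implicit Types (u v w : V) (K Z : {set V}).

Definition color_degree v : nat :=
  size (undup [seq col G v u | u <- enum (adj G v)]).

Definition colors_in K : seq C :=
  undup [seq col G p.1 p.2
        | p <- enum [pred p : V * V | [&& p.1 \in K, p.2 \in K & adj G p.1 p.2]]].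

Definition complete_on K : Prop :=
  {in K &, forall u v, u != v -> adj G u v}.

Definition has_properly_colored_C4 : Prop :=
  exists a b c d,
    [/\ uniq [:: a; b; c; d],
        [/\ adj G a b, adj G b c, adj G c d & adj G d a] &
        [/\ col G a b != col G b c, col G b c != col G c d,
            col G c d != col G d a & col G d a != col G a b]].

Definition rainbow_triangle u v w : Prop :=
  [/\ adj G u v, adj G v w, adj G u w &
      uniq [:: col G u v; col G v w; col G u w]].

(* The graphs K of the recursion are the induced subgraphs G[K]. *)
Definition complete_card_colors K : Prop :=
  complete_on K /\ size (colors_in K) = #|K|.

(* [layered K Z]: G[K] has a layered structure with center part G[Z]. *)
Inductive layered : {set V} -> {set V} -> Prop :=
| layered_vertex K Z v x :
    complete_card_colors K -> v \in K ->
    {in K :\ v, forall u, col G v u = x} ->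
    layered (K :\ v) Z ->
    layered K Z
| layered_triangle K Z u v w :
    complete_card_colors K -> u \in K -> v \in K -> w \in K ->
    rainbow_triangle u v w ->
    {in K :\: [set u; v; w], forall y,
      [/\ col G u y = col G u v, col G v y = col G v w &
          col G w y = col G u w]} ->
    layered (K :\: [set u; v; w]) Z ->
    layered K Z
| layered_center K v x :
    complete_card_colors K -> v \in K ->
    {in K :\ v &, injective (col G v)} ->
    {in K :\ v &, forall y z, y != z -> col G y z = x} ->
    {in K :\ v, forall y, col G v y != x} ->
    layered K K.

End EdgeColored.

(* Main.v *)
(* Deleting a vertex [v] lowers the sum [S] of the color degrees by the number of
   colors at [v] plus the number of vertices at which an edge to [v] is the only
   edge of its color; summed over all [v], these losses are at most [2 S], with
   equality only if the coloring is proper. Take a graph on [n] vertices without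
   properly colored [C4] and with [2 S >= n (n + 1)]. If an edge can be deleted
   without violating this bound, induction makes the smaller graph complete, a
   contradiction. Otherwise either the coloring is proper, so that the graph is
   [C4]-free and a count of the paths of length two gives [n <= 3], or
   [2 S = n (n + 1)] and some vertex has loss at most [n]. Deleting that vertex,
   induction shows that the graph is a tournament in which the arc [a -> b] has
   the color [f a], for an injective [f], and every vertex has an out-neighbour.
   The properly colored [C4]s of such a graph are the directed 4-cycles, and in a
   tournament without directed 4-cycles every strong component is a single vertex
   or a 3-cycle: these are the layers. *)
Require Import Defs.
From mathcomp Require Import all_boot zify.

Set Implicit Arguments.
Unset Strict Implicit.
Unset Printing Implicit Defensive.

(** * Numbers of colors, and elements whose color is not repeated *)

Section NumColors.
Variables (V : finType) (C : eqType).
Implicit Types (c : V -> C) (A : {set V}).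

Definition num_colors c A := size (undup [seq c u | u <- enum A]).

Definition unique_color c A u := [forall w in A, (c w == c u) ==> (w == u)].

Lemma unique_colorP c A u :
  reflect {in A, forall w, c w = c u -> w = u} (unique_color c A u).
Proof.
apply: (iffP forall_inP) => h w wA; first by move/eqP=> e; apply/eqP/(implyP (h w wA)).
by apply/implyP=> /eqP e; apply/eqP/h.
Qed.

Lemma num_colors_le c A : num_colors c A <= #|A|.
Proof. by rewrite (leq_trans (size_undup _)) // size_map -cardE. Qed.

Lemma num_colors_del c A u :
  u \in A -> num_colors c A = num_colors c (A :\ u) + unique_color c A u.
Proof.
move=> uA.
have pe : perm_eq (enum A) (u :: enum (A :\ u)).
  apply: uniq_perm; rewrite ?enum_uniq //= ?mem_enum ?in_setD1 ?eqxx ?enum_uniq //.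
  by move=> w; rewrite inE !mem_enum in_setD1; case: eqP => // ->.
have -> : num_colors c A = size (undup (c u :: [seq c w | w <- enum (A :\ u)])).
  by apply/perm_size/perm_undup/perm_mem; rewrite -map_cons; apply: perm_map.
rewrite /=; case: ifP => [/mapP[w] | cu].
  rewrite mem_enum in_setD1 => /andP[wu wA] e.
  suff -> : unique_color c A u = false by rewrite addn0.
  by apply/unique_colorP=> /(_ w wA (esym e)) e'; rewrite e' eqxx in wu.
suff -> : unique_color c A u by rewrite addn1.
apply/unique_colorP=> w wA e; apply/eqP; apply: contraFT cu => wu.
by apply/mapP; exists w; rewrite // mem_enum in_setD1 wu.
Qed.

Lemma unique_colors_uniq c A :
  uniq [seq c u | u <- enum [set u in A | unique_color c A u]].
Proof.
rewrite map_inj_in_uniq ?enum_uniq // => u w; rewrite !mem_enum !inE.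
by move=> /andP[uA _] /andP[_ /unique_colorP h]; apply: h.
Qed.

Lemma unique_colors_le c A :
  #|[set u in A | unique_color c A u]| <= num_colors c A.
Proof.
rewrite cardE -(size_map c); apply: uniq_leq_size (unique_colors_uniq c A) _.
move=> x /mapP[u]; rewrite mem_enum inE => /andP[uA _] ->.
by rewrite mem_undup map_f ?mem_enum.
Qed.

(** The uniquely colored elements have distinct colors; an element with a repeated color would
    contribute one more. *)
Lemma all_unique_colors c A u :
  num_colors c A <= #|[set u in A | unique_color c A u]| ->
  u \in A -> unique_color c A u.
Proof.
move=> le uA; apply: contraLR le => nu; rewrite -ltnNge.
rewrite cardE -(size_map c) -/(size (c u :: _)).
apply: uniq_leq_size => [|x].
  rewrite /= unique_colors_uniq andbT; apply/mapP=> -[w].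
  rewrite mem_enum inE => /andP[wA /unique_colorP h] /h e.
  by case/negP: nu; rewrite e //; apply/unique_colorP.
rewrite inE => /orP[/eqP-> | /mapP[w]]; first by rewrite mem_undup map_f ?mem_enum.
by rewrite mem_enum inE => /andP[wA _] ->; rewrite mem_undup map_f ?mem_enum.
Qed.

End NumColors.

(** * Deleting vertices and edges, and the effect on color degrees *)

Section Subgraphs.
Variables (V : finType) (C : eqType).
Implicit Types (G : ecgraph V C) (K : {set V}).

Definition nbhd G v : {set V} := [set u | adj G v u].

Lemma color_degreeE G v : color_degree G v = num_colors (col G v) (nbhd G v).
Proof.
rewrite /color_degree /num_colors; congr (size (undup (map _ _))).
by apply: eq_enum => u; rewrite inE.
Qed.

Lemma adj_neq G a b : adj G a b -> a != b.
Proof. by apply: contraTneq => ->; rewrite adj_irr. Qed.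

Section Restrict.
Variables (G : ecgraph V C) (r : rel V) (r_sym : symmetric r).

Fact restrict_sym : symmetric [rel a b | adj G a b && r a b].
Proof. by move=> a b /=; rewrite adj_sym r_sym. Qed.
Fact restrict_irr : irreflexive [rel a b | adj G a b && r a b].
Proof. by move=> a /=; rewrite adj_irr. Qed.
Fact restrict_col a b : [rel a b | adj G a b && r a b] a b -> col G a b = col G b a.
Proof. by case/andP=> /col_sym. Qed.

Definition restrict := ECGraph restrict_sym restrict_irr restrict_col.

Lemma restrict_C4 : has_properly_colored_C4 restrict -> has_properly_colored_C4 G.
Proof.
case=> a [b [c [d [u [/andP[? _] /andP[? _] /andP[? _] /andP[? _]] h]]]].
by exists a, b, c, d.
Qed.

End Restrict.

Fact avoid_vertex_sym (v : V) : symmetric [rel a b | (a != v) && (b != v)].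
Proof. by move=> a b /=; rewrite andbC. Qed.
Definition del_vertex G v := restrict G (avoid_vertex_sym v).

Fact avoid_edge_sym (x y : V) :
  symmetric [rel a b | ~~ ((a == x) && (b == y) || (a == y) && (b == x))].
Proof. by move=> a b /=; rewrite orbC ![(b == _) && _]andbC. Qed.
Definition del_edge G x y := restrict G (avoid_edge_sym x y).

(** Not symmetric: [u] is the end that loses a color when the edge is deleted. *)
Definition unique_at G u v := adj G u v && unique_color (col G u) (nbhd G u) v.

Lemma unique_atE G u v :
  unique_at G u v = (v \in [set w in nbhd G u | unique_color (col G u) (nbhd G u) w]).
Proof. by rewrite !inE. Qed.

Lemma color_degree_remove G H u v :
    col H u =1 col G u -> adj G u v -> nbhd H u = nbhd G u :\ v ->
  color_degree G u = color_degree H u + unique_at G u v.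
Proof.
move=> eqc a eqN; rewrite !color_degreeE /unique_at a (@num_colors_del _ _ _ _ v) ?inE //.
by rewrite eqN /num_colors (eq_map eqc).
Qed.

Lemma eq_color_degree G H u :
  col H u =1 col G u -> nbhd H u = nbhd G u -> color_degree G u = color_degree H u.
Proof. by move=> eqc eqN; rewrite !color_degreeE eqN /num_colors (eq_map eqc). Qed.

Lemma color_degree_le G v : color_degree G v <= #|nbhd G v|.
Proof. by rewrite color_degreeE num_colors_le. Qed.

Lemma sum_color_degree_del_vertex G v :
  \sum_u color_degree G u =
    \sum_u color_degree (del_vertex G v) u
      + (color_degree G v + \sum_u unique_at G u v).
Proof.
have degE u : u != v ->
    color_degree G u = color_degree (del_vertex G v) u + unique_at G u v.
  move=> uv; case: (boolP (adj G u v)) => a.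
    by apply: color_degree_remove => //; apply/setP=> w; rewrite !inE /= uv andbC.
  rewrite /unique_at (negbTE a) addn0; apply: eq_color_degree => //.
  by apply/setP=> w; rewrite !inE /= uv; case: eqP => [->|]; rewrite ?andbT // (negbTE a).
rewrite (bigD1 v) //= [X in _ = X + _](bigD1 v) //= [\sum_u (unique_at G u v : nat)](bigD1 v) //=.
have -> : color_degree (del_vertex G v) v = 0.
  apply/eqP; rewrite -leqn0 (leq_trans (color_degree_le _ _)) //.
  by rewrite leqn0 cards_eq0; apply/eqP/setP=> w; rewrite !inE /= eqxx andbF.
have -> : unique_at G v v = false by rewrite /unique_at adj_irr.
rewrite (eq_bigr _ degE) big_split /=; lia.
Qed.

(** Only the end [y] can lose a color. *)
Lemma sum_color_degree_del_edge G x y : adj G x y -> ~~ unique_at G x y ->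
  \sum_u color_degree G u <= \sum_u color_degree (del_edge G x y) u + 1.
Proof.
move=> a nu; have xy := adj_neq a.
rewrite (bigD1 x) //= (bigD1 y) 1?eq_sym //= [\sum_u _](bigD1 x) //=.
rewrite [X in _ + X + _](bigD1 y) 1?eq_sym //=.
rewrite (@color_degree_remove G (del_edge G x y) x y) // ?(negbTE nu); first last.
  by apply/setP=> w; rewrite !inE /= eqxx (negbTE xy) /= orbF andbC.
rewrite (@color_degree_remove G (del_edge G x y) y x) //; first last.
- by apply/setP=> w; rewrite !inE /= eqxx (eq_sym y) (negbTE xy) /= andbC.
- by rewrite adj_sym.
rewrite (@eq_bigr _ _ _ _ _ _ _ (color_degree (del_edge G x y))).
  by case: (unique_at G y x) => /=; lia.
move=> u /andP[ux uy]; apply: eq_color_degree => //.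
by apply/setP=> w; rewrite !inE /= (negbTE ux) (negbTE uy) andbT.
Qed.

Lemma no_C4 G a b c d : ~ has_properly_colored_C4 G -> uniq [:: a; b; c; d] ->
    adj G a b -> adj G b c -> adj G c d -> adj G d a ->
  [|| col G a b == col G b c, col G b c == col G c d,
      col G c d == col G d a | col G d a == col G a b].
Proof.
move=> no u ab bc cd da; apply/negP=> /negP; rewrite !negb_or => /and4P[? ? ? ?].
by apply: no; exists a, b, c, d.
Qed.

(** Allows the existence of a properly colored [C4] to be proved by contradiction. *)
Lemma C4_decidable G : decidable (has_properly_colored_C4 G).
Proof.
pose p (t : V * V * (V * V)) := let: (a, b, (c, d)) := t in
  [&& uniq [:: a; b; c; d],
      [&& adj G a b, adj G b c, adj G c d & adj G d a] &
      [&& col G a b != col G b c, col G b c != col G c d,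
          col G c d != col G d a & col G d a != col G a b]].
apply: (@decP _ [exists t, p t]); apply: (iffP existsP).
  by move=> [[[a b] [c d]] /and3P[u /and4P e /and4P h]]; exists a, b, c, d.
by move=> [a [b [c [d [u e h]]]]]; exists (a, b, (c, d)); apply/and3P; split=> //; apply/and4P.
Qed.

(* [col G a b = f a] means that the tournament has the arc [a -> b]. *)
Definition out_coloring G K (f : V -> C) :=
  [/\ complete_on G K, {in K &, injective f},
      {in K &, forall a b, a != b -> col G a b = f a \/ col G a b = f b} &
      {in K, forall a, exists2 b, b \in K & b != a /\ col G a b = f a}].

(** Deleting a vertex only isolates it, as the type [V] is fixed. The order of the graph is
    therefore tracked by a set [K] that carries all edges. *)
Definition supported_on G K := forall a b, adj G a b -> a \in K.

End Subgraphs.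

(** * Proper colorings: counting paths of length two *)

Section ProperColoring.
Variables (V : finType) (C : eqType) (G : ecgraph V C) (K : {set V}).
Hypotheses (suppG : supported_on G K)
           (properG : forall u v, adj G u v -> unique_at G u v)
           (noC4 : ~ has_properly_colored_C4 G).

Lemma proper_neq a b c : adj G a b -> adj G a c -> b != c -> col G a b != col G a c.
Proof.
move=> ab ac; apply: contraNneq => e.
have /andP[_ /unique_colorP h] := properG ac.
by rewrite (h b) // inE.
Qed.

Lemma proper_color_degree v : color_degree G v = #|nbhd G v|.
Proof.
apply/eqP; rewrite eqn_leq color_degree_le color_degreeE.
apply: leq_trans (unique_colors_le _ _); apply/subset_leq_card/subsetP=> u uN.
by rewrite -unique_atE properG //; rewrite inE in uN.
Qed.

Lemma nbhd_sub v : nbhd G v \subset K :\ v.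
Proof.
apply/subsetP=> u; rewrite !inE => a; rewrite eq_sym (adj_neq a) /=.
by rewrite adj_sym in a; apply: suppG a.
Qed.

Lemma card_nbhd v : v \in K -> #|nbhd G v| <= #|K|.-1.
Proof. by move=> vK; rewrite (cardsD1 v K) vK; apply/subset_leq_card/nbhd_sub. Qed.

Lemma nbhd_out v : v \notin K -> #|nbhd G v| = 0.
Proof.
move=> vK; apply/eqP; rewrite cards_eq0; apply/eqP/setP=> u; rewrite !inE.
by apply: contraNF vK => /suppG.
Qed.

(** The sum counts the paths [v u w] with [w != v]. Two of them with the same end [w] would form a
    4-cycle, which is properly colored here. *)
Lemma cherries_at v : v \in K -> \sum_(u in nbhd G v) #|nbhd G u|.-1 <= #|K|.-1.
Proof.
move=> vK; rewrite (eq_bigr (fun u => \sum_(w in K :\ v) adj G u w)); last first.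
  move=> u; rewrite inE => a.
  have vu : v \in nbhd G u by rewrite inE adj_sym.
  rewrite -big_mkcondr sum1_card (cardsD1 v (nbhd G u)) vu; apply: eq_card => w.
  rewrite !inE unfold_in /= !inE; case: (w == v) => //=.
  by case: (boolP (adj G u w)); rewrite ?andbF // adj_sym => /suppG ->.
rewrite exchange_big /= (cardsD1 v K) vK /= -sum1_card; apply: leq_sum => w.
rewrite !inE => /andP[wv wK]; rewrite -big_mkcondr sum1_card.
apply/card_le1_eqP => u1 u2; rewrite -!topredE /= !inE => /andP[a1 b1] /andP[a2 b2].
apply/eqP/negP=> /negP ne.
have uq : uniq [:: v; u1; w; u2].
  rewrite /= !inE !negb_or (eq_sym v w) wv (adj_neq a1) (adj_neq a2) (adj_neq b1).
  by rewrite (eq_sym w) (adj_neq b2) eq_sym ne.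
have neq x y z : adj G x y -> adj G x z -> y != z ->
    (col G y x == col G x z) = false.
  by move=> xy xz yz; rewrite -(col_sym xy); apply/negbTE/proper_neq.
have := no_C4 noC4 uq a1 b1; rewrite !(adj_sym G _ v) !(adj_sym G w).
rewrite !neq // 1?eq_sym // 1?(adj_sym G _ v) // 1?(adj_sym G w) //.
by move=> /(_ b2 a2).
Qed.

(** Sum of [cherries_at] over [v], regrouped by the middle vertex. *)
Lemma cherry_count :
  \sum_(u in K) #|nbhd G u| * #|nbhd G u|.-1 <= #|K| * #|K|.-1.
Proof.
rewrite -sum_nat_const; apply: leq_trans (leq_sum _ cherries_at).
rewrite (exchange_big_dep (mem K)) /= => [|v u _]; last first.
  by rewrite inE adj_sym => /suppG.
apply: leq_sum => u uK; rewrite sum_nat_const leq_mul2r; apply/orP; right.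
apply/subset_leq_card/subsetP=> w; rewrite !inE => a; rewrite unfold_in /=.
by rewrite adj_sym in a; rewrite (suppG a) inE.
Qed.

Let S := \sum_v color_degree G v.

Lemma sum_proper : S = \sum_(v in K) #|nbhd G v|.
Proof.
rewrite /S (bigID (mem K)) /= [X in _ + X]big1 ?addn0.
  by apply: eq_bigr => v _; apply: proper_color_degree.
by move=> v vK; rewrite proper_color_degree nbhd_out.
Qed.

(** For [n = #|K| > 0], a quadratic inequality summed over the degrees and combined with
    [cherry_count] yields [(n - 1) (n - 3) <= 0], while degrees at most [n - 1] force [n >= 3]. *)
Lemma proper_order : #|K| * (#|K| + 1) <= 2 * S -> #|K| = 0 \/ #|K| = 3 /\ S = 6.
Proof.
rewrite sum_proper; set n := #|K| => le.
(* [(2 d - (n + 1))^2 >= 0] for every degree [d]. *)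
have tangent : \sum_(u in K) (4 * n * #|nbhd G u|)
    <= \sum_(u in K) (4 * (#|nbhd G u| * #|nbhd G u|.-1) + (n + 1) ^ 2).
  apply: leq_sum => u _; case: #|nbhd G u| => [|d]; first by rewrite muln0.
  have [+ _] := nat_Cauchy (2 * d.+1) (n + 1); rewrite -!mulnn /=; clearbody n; nia.
rewrite big_split /= -!big_distrr /= sum_nat_const -/n in tangent.
have up : \sum_(v in K) #|nbhd G v| <= n * n.-1.
  by rewrite -sum_nat_const; apply: leq_sum => v; apply: card_nbhd.
move: cherry_count; rewrite -/n => ch.
move: le up tangent ch; move: (\sum_(v in K) _) => s; move: (\sum_(v in K) _) => t le up tg ch.
clearbody n; case: n le up tg ch => [|[|[|[|n]]]] /=; nia.
Qed.

(** Three degrees at most 2 with sum 6 make a triangle, rainbow since the coloring is proper.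
    Orienting it cyclically, each vertex takes the color of its outgoing edge. *)
Lemma proper_triangle : #|K| = 3 -> S = 6 -> exists f, out_coloring G K f.
Proof.
rewrite sum_proper => K3 S6.
have nbE v : v \in K -> nbhd G v = K :\ v.
  move=> vK; apply/eqP; rewrite eqEcard nbhd_sub /=.
  have := cardsD1 v K; rewrite vK K3 => /succn_inj Kv.
  move: S6; rewrite (big_setD1 v) //= -Kv.
  have : \sum_(u in K :\ v) #|nbhd G u| <= \sum_(u in K :\ v) 2.
    by apply: leq_sum => u; rewrite inE => /andP[_ /card_nbhd]; rewrite K3.
  by rewrite sum_nat_const -Kv; lia.
have cK : complete_on G K.
  by move=> u v uK vK uv; have := nbE u uK; move/setP/(_ v); rewrite !inE vK eq_sym uv.
have [a [b [c [uq eK]]]] :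
    exists a b c, uniq [:: a; b; c] /\ K =i [:: a; b; c].
  have := mem_enum K; move: K3 (enum_uniq K); rewrite cardE.
  case: (enum K) => [|a [|b [|c []]]] //= _ uq eK.
  by exists a, b, c; split=> // x; rewrite -eK.
move: uq; rewrite /= !inE negb_or andbT => /andP[/andP[ab ac] bc].
have [aK bK cK'] : [/\ a \in K, b \in K & c \in K].
  by rewrite !eK !inE !eqxx !orbT.
have [ab' bc' ca'] : [/\ adj G a b, adj G b c & adj G c a].
  by rewrite !cK // eq_sym.
have [c1 c2 c3] : [/\ col G a b != col G b c, col G b c != col G c a &
    col G c a != col G a b].
  have ba' : adj G b a by rewrite adj_sym.
  have cb' : adj G c b by rewrite adj_sym.
  have ac' : adj G a c by rewrite adj_sym.
  by split; [rewrite (col_sym ab') | rewrite (col_sym bc') | rewrite (col_sym ca')];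
    rewrite proper_neq // eq_sym.
exists (fun u => if u == a then col G a b else if u == b then col G b c else col G c a).
have ba : b == a = false by rewrite eq_sym (negbTE ab).
have ca : c == a = false by rewrite eq_sym (negbTE ac).
have cb : c == b = false by rewrite eq_sym (negbTE bc).
split=> //.
- move=> u w; rewrite !eK !inE => /or3P[]/eqP-> /or3P[]/eqP->;
    rewrite /= ?eqxx ?ba ?ca ?cb // => /eqP;
    by rewrite ?(negbTE c1) ?(negbTE c2) ?(negbTE c3) // eq_sym
         ?(negbTE c1) ?(negbTE c2) ?(negbTE c3).
- move=> u w; rewrite !eK !inE => /or3P[]/eqP-> /or3P[]/eqP->;
    rewrite ?eqxx ?ba ?ca ?cb //= => _;
    rewrite -?(col_sym ab') -?(col_sym bc') -?(col_sym ca'); by [left | right].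
- move=> u; rewrite eK !inE => /or3P[]/eqP->; [exists b|exists c|exists a];
    rewrite // ?eqxx ?ba ?cb ?ca //.
Qed.

End ProperColoring.

(** * Edges as arcs of a tournament *)

Section OutColoring.
Variables (V : finType) (C : eqType) (G : ecgraph V C) (K : {set V}) (f : V -> C).
Hypothesis outG : out_coloring G K f.

Lemma out_adj a b : a \in K -> b \in K -> a != b -> adj G a b.
Proof. by case: outG => h _ _ _; apply: h. Qed.

Lemma out_inj a b : a \in K -> b \in K -> f a = f b -> a = b.
Proof. by case: outG => _ h _ _; apply: h. Qed.

Lemma out_col_sym a b : a \in K -> b \in K -> a != b -> col G a b = col G b a.
Proof. by move=> aK bK ab; apply/col_sym/out_adj. Qed.

(** Injectivity of [f] makes the alternatives exclusive, so each edge has one direction. *)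
Lemma out_or a b : a \in K -> b \in K -> a != b ->
  col G a b = f a /\ col G a b != f b \/ col G a b = f b /\ col G a b != f a.
Proof.
move=> aK bK ab; have ne : f a != f b by apply: contra_neq ab; apply: out_inj.
by case: outG => _ _ /(_ a b aK bK ab) [] -> _; [left | right]; rewrite ?(eq_sym (f b)).
Qed.

End OutColoring.

(** * Extending the tournament to a vertex of loss [#|K|] *)

Section Extend.
Variables (V : finType) (C : eqType) (G : ecgraph V C) (K : {set V}) (v : V).
Variable f : V -> C.
Hypotheses (suppG : supported_on G K) (noC4 : ~ has_properly_colored_C4 G).
Hypotheses (vK : v \in K) (outH : out_coloring G (K :\ v) f).
Hypothesis lossE : color_degree G v + \sum_u unique_at G u v = #|K|.

Let H := K :\ v.
(** In the extended tournament [N] becomes the out-neighbourhood of [v], and [M] its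
    in-neighbourhood. *)
Let N := [set u | unique_at G u v].
Let M := H :\: N.

Lemma in_H u : (u \in H) = (u != v) && (u \in K).
Proof. by rewrite !inE. Qed.

Lemma H_neq u : u \in H -> v != u.
Proof. by rewrite in_H eq_sym => /andP[]. Qed.

Lemma N_sub : N \subset H.
Proof.
apply/subsetP=> u; rewrite inE in_H => /andP[a _].
by rewrite (adj_neq a) (suppG a).
Qed.

Lemma N_adj u : u \in N -> adj G v u.
Proof. by rewrite inE adj_sym => /andP[]. Qed.

Lemma N_unique u b : u \in N -> b \in H -> b != u -> col G u b != col G v u.
Proof.
move=> uN bH bu; have uH := subsetP N_sub u uN.
rewrite (col_sym (N_adj uN)); move: uN; rewrite inE => /andP[a /unique_colorP h].
apply: contraNneq (H_neq bH) => e; rewrite eq_sym; apply/eqP/h => //.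
by rewrite inE; apply: (out_adj outH); rewrite // eq_sym.
Qed.

Lemma loss_card : color_degree G v + #|N| = #|H|.+1.
Proof.
have -> : #|H|.+1 = #|K| by rewrite (cardsD1 v K) vK.
by rewrite -lossE -big_mkcond sum1_card cardsE.
Qed.

Lemma N_nonempty : exists w, w \in N.
Proof.
apply/set0Pn; rewrite -card_gt0.
have : color_degree G v <= #|H|.
  apply: leq_trans (color_degree_le _ _) (subset_leq_card _).
  apply/subsetP=> u; rewrite inE in_H => a; rewrite eq_sym (adj_neq a) /=.
  by rewrite adj_sym in a; apply: suppG a.
by have := loss_card; lia.
Qed.

(* Otherwise every other vertex would dominate both [u1] and [u2], and one of
   those two would have no out-neighbour. *)
Lemma N_mono u1 u2 : u1 \in N -> u2 \in N -> col G v u1 = col G v u2.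
Proof.
wlog : u1 u2 / u1 != u2 /\ col G u1 u2 = f u1.
  move=> wl u1N u2N; case: (altP (u1 =P u2)) => [-> // | ne].
  have [u1H u2H] := (subsetP N_sub u1 u1N, subsetP N_sub u2 u2N).
  case: (out_or outH u1H u2H ne) => -[e _]; first exact: wl.
  by apply/esym/wl => //; rewrite eq_sym -(out_col_sym outH).
move=> [ne e12] u1N u2N; apply/eqP/negP=> /negP cne.
have [u1H u2H] := (subsetP N_sub u1 u1N, subsetP N_sub u2 u2N).
case: (outH) => _ _ _ /(_ u2 u2H) [a aH [au2 e]].
have au1 : a != u1.
  apply: contra_neq ne => ea; apply: (out_inj outH) => //.
  by rewrite -e12 -e ea (out_col_sym outH) // -ea.
have uq : uniq [:: v; u1; a; u2].
  by rewrite /= !inE !negb_or !H_neq // au2 (eq_sym u1) au1 ne.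
have u1a : adj G u1 a by apply: (out_adj outH); rewrite // eq_sym.
have au2' : adj G a u2 by apply: (out_adj outH).
have u2v : adj G u2 v by rewrite adj_sym N_adj.
case/or4P: (no_C4 noC4 uq (N_adj u1N) u1a au2' u2v) => /eqP e'.
- by case/eqP: (N_unique u1N aH au1).
- case: (out_or outH u1H aH); rewrite 1?eq_sym // e' (col_sym au2') e => -[].
    by move=> /(out_inj outH u2H u1H) e21; rewrite e21 eqxx in ne.
  by move=> /(out_inj outH u2H aH) e21; rewrite e21 eqxx in au2.
- by case/eqP: (N_unique u2N aH au2); rewrite -(col_sym au2') e' (col_sym u2v).
- by case/eqP: cne; rewrite -e' (col_sym u2v).
Qed.

(* The color degree of [v] is [#|M| + 1], and [N] accounts for only one color. *)
Lemma M_spec w : w \in N ->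
  [/\ {in M, forall u, adj G v u}, {in M &, injective (col G v)} &
      {in M, forall u, col G v u != col G v w}].
Proof.
move=> wN; set s := col G v w :: [seq col G v u | u <- enum (M :&: nbhd G v)].
have le1 : color_degree G v <= size (undup s).
  apply: uniq_leq_size (undup_uniq _) _ => x; rewrite !mem_undup.
  case/mapP=> u; rewrite mem_enum => uv ->; have a : adj G v u := uv; rewrite inE.
  case: (boolP (u \in N)) => uN; first by rewrite (N_mono uN wN) eqxx.
  apply/orP; right; apply: map_f; rewrite mem_enum inE inE uN in_H inE.
  rewrite eq_sym (adj_neq a) /= andbC; apply/andP; split=> //.
  by rewrite adj_sym in a; apply: suppG a.
have le2 : size s <= #|M :&: nbhd G v|.+1 by rewrite /s /= size_map -cardE.
have le3 : #|M :&: nbhd G v| <= #|M| by apply/subset_leq_card/subsetIl.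
have cM : #|M| + #|N| = #|H|.
  by rewrite cardsD (setIidPr N_sub) subnK // subset_leq_card ?N_sub.
(* Since the color degree is [#|M| + 1], all of [le1], [le2] and [le3] are equalities, and so is
   [size_undup s]. *)
have us : uniq s by rewrite -[uniq s]negbK -ltn_size_undup; have := loss_card; lia.
have sub : M \subset nbhd G v.
  apply/setIidPl/eqP; rewrite eqEcard subsetIl /=; have := loss_card.
  have := size_undup s; lia.
move: us; rewrite /s (setIidPl sub) /= => /andP[nw us]; split=> [u uM|u1 u2 u1M u2M e|u uM].
- by have := subsetP sub u uM; rewrite inE.
- by apply: (elimT (dinjectiveP (col G v) M) us) e.
- by apply: contra nw => /eqP <-; apply: map_f; rewrite mem_enum.
Qed.

(** Needed for the injectivity of the extended [f]. Let [b -> c]. If [b] or [c] is in [N],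
    [N_unique] applies to the edge [b c]. Otherwise, if [f b] were the color of [v w], the cycle
    [v w b c] would have this color exactly on [v w] and [b c]. *)
Lemma N_color_new w b : w \in N -> b \in H -> f b != col G v w.
Proof.
move=> wN bH; have wH := subsetP N_sub w wN; have [M1 M2 M3] := M_spec wN.
case: (outH) => _ _ _ /(_ b bH) [c cH [cb e]].
have bc : b != c by rewrite eq_sym.
case: (boolP (b \in N)) => bN.
  by rewrite -(N_mono bN wN) -e N_unique.
have bM : b \in M by rewrite inE bN.
have cN : c \notin N \/ f b != col G v w.
  case: (boolP (c \in N)) => cN; last by left.
  by right; rewrite -e -(N_mono cN wN) (out_col_sym outH) // N_unique.
case: cN => // cN; have cM : c \in M by rewrite inE cN.
apply/negP=> /eqP fb.
have bw : b != w by apply: contraNneq bN => ->.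
have cw : c != w by apply: contraNneq cN => ->.
have wb : w != b by rewrite eq_sym.
have uq : uniq [:: v; w; b; c].
  by rewrite /= !inE !negb_or !H_neq // wb (eq_sym w) cw bc.
have cv : adj G c v by rewrite adj_sym M1.
case/or4P: (no_C4 noC4 uq (N_adj wN) (out_adj outH wH bH wb) (out_adj outH bH cH bc) cv)
  => /eqP e'.
- by case/eqP: (N_unique wN bH bw).
- by case/eqP: (N_unique wN bH bw); rewrite e' e.
- by case/eqP: (M3 c cM); rewrite -fb -e e' (col_sym cv).
- by case/eqP: (M3 c cM); rewrite -e' (col_sym cv).
Qed.

(* Serves to refute these hypotheses: a vertex [u] of [M] cannot repeat, on its
   edge to [v], the color of an arc [a -> u]. *)
Lemma M_out_only u a w z :
    u \in M -> a \in H -> a != u -> col G u a = f a -> col G v u = f a -> w \in N ->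
  z \in H -> z != u -> col G u z = f u -> z = w.
Proof.
move=> uM aH au ua vu wN zH zu uz; apply/eqP/negP=> /negP zw.
have [M1 M2 M3] := M_spec wN; have wH := subsetP N_sub w wN.
have [uN uH] : u \notin N /\ u \in H by move: uM; rewrite inE => /andP[].
have uw : u != w by apply: contraNneq uN => ->.
have uz' : u != z by rewrite eq_sym.
(* With [z != w] the cycle [v u z w] is properly colored: its colors are [f a], [f u], then [f z] or
   [f w], then the color of [N]. *)
have uq : uniq [:: v; u; z; w].
  by rewrite /= !inE !negb_or !H_neq // uz' uw zw.
have wv : adj G w v by rewrite adj_sym N_adj.
case/or4P: (no_C4 noC4 uq (M1 u uM) (out_adj outH uH zH uz') (out_adj outH zH wH zw) wv)
  => /eqP e.
- by move: au; rewrite (out_inj outH uH aH) ?eqxx // -uz -e vu.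
- case: (out_or outH zH wH zw); rewrite -e uz => -[].
    by move=> /(out_inj outH uH zH) e' _; rewrite e' eqxx in zu.
  by move=> /(out_inj outH uH wH) e' _; rewrite e' eqxx in uw.
- by case/eqP: (N_unique wN zH zw); rewrite (out_col_sym outH) 1?eq_sym // e (col_sym wv).
- by case/eqP: (N_color_new wN aH); rewrite -vu -e (col_sym wv).
Qed.

(** Otherwise [v u] has the color of an arc [a -> u], and [w] is the only out-neighbour of [u]. The
    arcs then form a cycle [a -> u -> w -> a] with [a] in [M]. If [v a] has color [f a], it repeats
    the color of [v u]; if not, [w] is also the only out-neighbour of [a], against [a -> u]. *)
Lemma M_color u : u \in M -> col G v u = f u.
Proof.
move=> uM; have [w wN] := N_nonempty.
have [M1 M2 M3] := M_spec wN; have wH := subsetP N_sub w wN.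
(* As [x] is not in [N], the color of [x v] recurs on some other edge [x a], where it is [f x] or
   [f a]. *)
have old x : x \in M -> col G v x = f x \/
    exists a, [/\ a \in H, a != x, col G x a = f a & col G v x = f a].
  move=> xM; have xv : adj G x v by rewrite adj_sym M1.
  have [xN xH] : x \notin N /\ x \in H by move: xM; rewrite inE => /andP[].
  move: xN; rewrite inE /unique_at xv /= => /forall_inPn /= [a].
  rewrite inE negb_imply => xa /andP[/eqP e av].
  have aH : a \in H by rewrite in_H av; rewrite adj_sym in xa; apply: suppG xa.
  have xa' := adj_neq xa.
  case: (out_or outH xH aH xa') => -[e' _]; rewrite -(col_sym xv) -e; first by left.
  by right; exists a; split; rewrite // eq_sym.
case: (old u uM) => // -[a [aH au ua vu]].
have [uN uH] : u \notin N /\ u \in H by move: uM; rewrite inE => /andP[].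
have only := M_out_only uM aH au ua vu.
have out_u : col G u w = f u.
  case: (outH) => _ _ _ /(_ u uH) [z zH [zu uz]].
  by rewrite -(only w z wN zH zu uz).
have uw : u != w by apply: contraNneq uN => ->.
have aw : a != w.
  apply: contraTneq au => aw; rewrite negbK; apply/eqP/(out_inj outH) => //.
  by rewrite -ua aw.
have aN : a \notin N.
  apply/negP=> aN; have := only a w aN wH _ out_u.
  by rewrite eq_sym => /(_ uw) wa; rewrite wa eqxx in aw.
have aM : a \in M by rewrite inE aN.
(* An out-neighbour [b != a] of [w] would make the cycle [v u b w] properly colored. *)
have out_w : col G w a = f w.
  case: (outH) => _ _ _ /(_ w wH) [b bH [bw wb]].
  case: (altP (b =P a)) => [<- // | ba].
  have bu : b != u.
    apply: contra_neq (uw) => bu; apply: (out_inj outH) => //.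
    by rewrite -out_u -wb bu (out_col_sym outH).
  have uq : uniq [:: v; u; b; w].
    by rewrite /= !inE !negb_or !H_neq // (eq_sym u) bu uw bw.
  have wv : adj G w v by rewrite adj_sym N_adj.
  have ub' : u != b by rewrite eq_sym.
  case/or4P: (no_C4 noC4 uq (M1 u uM) (out_adj outH uH bH ub') (out_adj outH bH wH bw) wv)
    => /eqP e.
  - case: (out_or outH uH bH ub'); rewrite -e vu => -[].
      by move=> /(out_inj outH aH uH) e' _; rewrite e' eqxx in au.
    by move=> /(out_inj outH aH bH) e' _; rewrite e' eqxx in ba.
  - case: (out_or outH uH bH ub'); rewrite e (out_col_sym outH bH wH bw) wb => -[].
      by move=> /(out_inj outH wH uH) e' _; rewrite e' eqxx in uw.
    by move=> /(out_inj outH wH bH) e' _; rewrite e' eqxx in bw.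
  - by case/eqP: (N_unique wN bH bw); rewrite -(col_sym wv) -e (out_col_sym outH bH wH bw).
  - by case/eqP: (N_color_new wN aH); rewrite -vu -e (col_sym wv).
case: (old a aM) => [e | [z [zH za az vz]]].
  by move: au; rewrite (M2 a u aM uM) ?eqxx // e vu.
have ua' : u != a by rewrite eq_sym.
have := M_out_only aM zH za az vz wN uH ua' _; rewrite (out_col_sym outH aH uH au) ua.
by move=> /(_ erefl) e; rewrite e eqxx in uw.
Qed.

Lemma extend_out_coloring : exists f', out_coloring G K f'.
Proof.
have [w wN] := N_nonempty; have wH := subsetP N_sub w wN.
have [M1 M2 M3] := M_spec wN.
have HK u : u \in K -> u != v -> u \in H by rewrite in_H => -> ->.
have adj_v u : u \in H -> adj G v u.
  by move=> uH; case: (boolP (u \in N)) => uN; [apply: N_adj | apply: M1; rewrite inE uN].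
have col_v u : u \in H -> col G v u = col G v w \/ col G v u = f u.
  move=> uH; case: (boolP (u \in N)) => uN; first by left; apply: N_mono.
  by right; apply: M_color; rewrite inE uN.
(* The color of [v] is the common color of its edges to [N], so that [w] is an out-neighbour of
   [v]. *)
exists (fun u => if u == v then col G v w else f u); split.
- move=> a b aK bK; case: (altP (a =P v)) => [-> vb | av ab].
    by apply/adj_v/HK; rewrite // eq_sym.
  case: (altP (b =P v)) => [-> | bv]; first by rewrite adj_sym; apply/adj_v/HK.
  by apply: (out_adj outH) => //; apply: HK.
- move=> a b aK bK /=; case: (altP (a =P v)) => [-> | av]; case: (altP (b =P v)) => [-> // | bv].
  + by move/esym/eqP; rewrite (negbTE (N_color_new wN (HK b bK bv))).
  + by move/eqP; rewrite (negbTE (N_color_new wN (HK a aK av))).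
  by apply: (out_inj outH); apply: HK.
- move=> a b aK bK; case: (altP (a =P v)) => [-> | av].
    by rewrite eq_sym => bv; rewrite (negbTE bv); apply/col_v/HK.
  case: (altP (b =P v)) => [-> _ | bv ab].
    by rewrite -(col_sym (adj_v a (HK a aK av))); case: (col_v a (HK a aK av)); auto.
  by case: (outH) => _ _ h _; apply: h => //; apply: HK.
- move=> a aK; case: (altP (a =P v)) => [-> | av].
    by exists w; rewrite ?(eq_sym w) ?H_neq //; move: wH; rewrite in_H => /andP[].
  case: (outH) => _ _ _ /(_ a (HK a aK av)) [b bH h]; exists b => //.
  by move: bH; rewrite in_H => /andP[].
Qed.

End Extend.

(** * Strong components of a tournament without directed 4-cycles *)

Section Layers.
Variables (V : finType) (C : eqType) (G : ecgraph V C) (f : V -> C).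
Hypothesis noC4 : ~ has_properly_colored_C4 G.

Definition dominates a b := (a != b) && (col G a b == f a).

Definition in_nbrs (K : {set V}) a := [set b in K | dominates b a].

Section OutColored.
Variable K : {set V}.
Hypothesis outG : out_coloring G K f.

Lemma dominates_or a b : a \in K -> b \in K -> a != b ->
  dominates b a = ~~ dominates a b.
Proof.
move=> aK bK ab; rewrite /dominates ab (eq_sym b) ab /= -(out_col_sym outG aK bK) //.
by case: (out_or outG aK bK ab) => -[-> /negbTE]; rewrite eqxx => ->.
Qed.

Lemma dominates_anti a b : a \in K -> b \in K -> dominates a b -> dominates b a = false.
Proof. by move=> aK bK d; rewrite dominates_or ?d //; case/andP: d. Qed.

Lemma out_nbr a : a \in K -> exists2 b, b \in K & dominates a b.
Proof.
case: outG => _ _ _ h /h[b bK [ba e]]; exists b => //.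
by rewrite /dominates eq_sym ba e eqxx.
Qed.

(** Such a cycle has the colors [f a], [f b], [f c], [f d] in turn, and [f] is injective. *)
Lemma no_directed_C4 a b c d : a \in K -> b \in K -> c \in K -> d \in K ->
  dominates a b -> dominates b c -> dominates c d -> ~~ dominates d a.
Proof.
move=> aK bK cK dK ab bc cd; apply/negP=> da.
have ac : a != c by apply: contraTneq (bc) => <-; rewrite dominates_anti.
have bd : b != d by apply: contraTneq (cd) => <-; rewrite dominates_anti.
have [/andP[nab /eqP eab] /andP[nbc /eqP ebc]] := conj ab bc.
have [/andP[ncd /eqP ecd] /andP[nda /eqP eda]] := conj cd da.
have uq : uniq [:: a; b; c; d].
  by rewrite /= !inE !negb_or nab ac (eq_sym a) nda nbc bd ncd.
have := no_C4 noC4 uq (out_adj outG aK bK nab) (out_adj outG bK cK nbc)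
  (out_adj outG cK dK ncd) (out_adj outG dK aK nda).
rewrite eab ebc ecd eda.
by case/or4P=> /eqP/(out_inj outG) e; move: nab nbc ncd nda; rewrite e ?eqxx.
Qed.

(** The colors are exactly the values of [f] on [K]: each [f a] occurs because [a] has an
    out-neighbour. *)
Lemma out_coloring_card : complete_card_colors G K.
Proof.
split; first by case: outG.
rewrite cardE -(size_map f); apply/perm_size/uniq_perm; rewrite ?undup_uniq //.
  rewrite map_inj_in_uniq ?enum_uniq // => a b; rewrite !mem_enum.
  exact: (out_inj outG).
move=> x; rewrite mem_undup; apply/mapP/mapP => [[[a b]] | [a]]; rewrite mem_enum.
  case/and3P=> /= aK bK ab ->.
  case: (out_or outG aK bK (adj_neq ab)) => -[-> _]; [exists a | exists b];
    by rewrite ?mem_enum.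
move=> aK ->; have [b bK /andP[ab /eqP e]] := out_nbr aK.
by exists (a, b); rewrite //= mem_enum inE /= aK bK (out_adj outG).
Qed.

(** All arcs between [T] and the rest leave [T], so vertices outside [T] keep their
    out-neighbours. *)
Lemma out_coloring_setD (T : {set V}) : T \subset K ->
  {in K :\: T & T, forall a b, dominates b a} -> out_coloring G (K :\: T) f.
Proof.
move=> TK dom; have DK : {subset K :\: T <= K} by apply/subsetP/subsetDl.
split.
- by move=> a b /DK aK /DK bK; apply: (out_adj outG).
- by move=> a b /DK aK /DK bK; apply: (out_inj outG).
- by case: outG => _ _ h _ a b /DK aK /DK bK; apply: h.
move=> a aD; have [b bK ab] := out_nbr (DK a aD).
have bT : b \notin T.
  apply: contraL (ab) => bT.
  by rewrite (dominates_anti bK (DK a aD) (dom a b aD bT)).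
exists b; first by rewrite inE bT.
by case/andP: ab => ab /eqP ->; rewrite eq_sym ab.
Qed.

(** Otherwise [p -> x -> q -> r -> p] is a directed 4-cycle. *)
Lemma cycle_dominates p q r x : p \in K -> q \in K -> r \in K -> x \in K ->
    dominates p q -> dominates q r -> dominates r p -> x != q ->
  dominates p x -> dominates q x.
Proof.
move=> pK qK rK xK pq qr rp xq px; rewrite dominates_or //; apply/negP=> dxq.
by case/negP: (no_directed_C4 pK xK qK rK px dxq qr).
Qed.

(* The initial strong component of a tournament without directed [C4]: the
   3-cycle is built on a vertex [v] of minimal in-degree, and a vertex
   dominating the cycle would have smaller in-degree than [v]. *)
Lemma initial_component : K != set0 ->
  (exists2 v, v \in K & {in K :\ v, forall y, dominates v y}) \/
  exists u v w, [/\ [/\ u \in K, v \in K & w \in K],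
    [/\ dominates u v, dominates v w & dominates w u] &
    {in K :\: [set u; v; w] & [set u; v; w], forall y x, dominates x y}].
Proof.
case/set0Pn=> v0 v0K; case: (arg_minnP (fun v => #|in_nbrs K v|) v0K) => v vK vmin.
case: (set_0Vmem (in_nbrs K v)) => [v_src | [a]].
  left; exists v => // y; rewrite !inE => /andP[yv yK].
  rewrite dominates_or //; apply/negP=> d.
  by have := in_set0 y; rewrite -v_src inE yK d.
rewrite inE => /andP[aK av]; right.
(* Such an [x] would have smaller in-degree than [v], since [x] itself is counted only at [v]. *)
have in_lt x : x \in K -> dominates x v ->
    ~ (forall z, z \in K -> dominates z x -> dominates z v).
  move=> xK xv h; have := vmin x xK; rewrite leqNgt => /negP; apply.
  apply: proper_card; apply/properP; split.
    by apply/subsetP=> z; rewrite !inE => /andP[zK zx]; rewrite zK h.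
  by exists x; rewrite !inE xK ?xv // /dominates eqxx.
(* Without such an [o], every vertex dominating [a] would dominate [v], against [in_lt]. *)
have [o oK /andP[vo oa]] : exists2 o, o \in K & dominates v o && dominates o a.
  apply/exists_inP; apply: contraPT (in_lt a aK av) => /exists_inPn no h; apply: h.
  move=> z zK za; have zv : v != z.
    by apply: contraTneq za => <-; rewrite dominates_anti.
  by rewrite dominates_or //; have := no z zK; rewrite za andbT.
exists v, o, a; split=> // x y; rewrite !inE !negb_or => /andP[/andP[/andP[xv xo] xa] xK] yT.
suff vx : dominates v x.
  have ox := cycle_dominates vK oK aK xK vo oa av xo vx.
  (* Domination of [x] spreads along the cycle [v -> o -> a -> v], so only [v] has to be treated. *)
  have ax := cycle_dominates oK aK vK xK oa av vo xa ox.
  by case/orP: yT => [/orP[]|] /eqP->.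
(* If [x -> v], then also [x -> a]; any [z -> x] must dominate [v], since otherwise
   [v -> z -> x -> a -> v]. This contradicts [in_lt]. *)
rewrite dominates_or //; apply/negP=> dxv; apply: (in_lt x xK dxv) => z zK zx.
have xa' : dominates x a.
  rewrite dominates_or 1?eq_sym //; apply/negP=> ax.
  by have := cycle_dominates aK vK oK xK av vo oa xv ax; rewrite dominates_anti.
have vz : v != z by apply: contraTneq zx => <-; rewrite dominates_anti.
rewrite dominates_or //; apply/negP=> dvz.
by case/negP: (no_directed_C4 vK zK xK aK dvz zx xa').
Qed.

End OutColored.

(** The initial component is removed repeatedly. A single vertex never exhausts [K], having an
    out-neighbour, so the last component is a 3-cycle: the center part. *)
Lemma layered_out_coloring K : K != set0 -> out_coloring G K f ->
  exists u v w, rainbow_triangle G u v w /\ layered G K [set u; v; w].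
Proof.
have [m] := ubnP #|K|; elim: m K => // m IH K Km K0 outG.
have cK := out_coloring_card outG.
case: (initial_component outG K0) => [[v vK dom] | [u [v [w [[uK vK wK] [uv vw wu] dom]]]]].
  have K'0 : K :\ v != set0.
    have [b bK /andP[vb _]] := out_nbr outG vK.
    by apply/set0Pn; exists b; rewrite !inE eq_sym vb.
  have outK' : out_coloring G (K :\ v) f.
    refine (out_coloring_setD outG _ _); first by rewrite sub1set.
    by move=> a b aD; rewrite inE => /eqP->; apply: dom.
  have K'm : #|K :\ v| < m by move: Km; rewrite (cardsD1 v K) vK; lia.
  have [a [b [c [rb ly]]]] := IH _ K'm K'0 outK'.
  exists a, b, c; split=> //; apply: (layered_vertex cK vK _ ly) => y yK.
  by case/andP: (dom y yK) => _ /eqP; apply.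
have [/andP[nuv /eqP cuv] /andP[nvw /eqP cvw]] := conj uv vw.
have [nwu /eqP cwu] := andP wu.
have nuw : u != w by rewrite eq_sym.
have cuw : col G u w = f w by rewrite (out_col_sym outG).
have inj := out_inj outG.
have fne x y : x \in K -> y \in K -> x != y -> f x != f y.
  by move=> xK yK; apply: contra_neq; apply: inj.
have rb : rainbow_triangle G u v w.
  split; try by apply: (out_adj outG).
  by rewrite /= !inE negb_or cuv cvw cuw !fne.
have TK : [set u; v; w] \subset K by rewrite !subUset !sub1set uK vK wK.
case: (eqVneq (K :\: [set u; v; w]) set0) => [D0 | K'0].
  have eK : K = [set u; v; w] by apply/eqP; rewrite eqEsubset TK -setD_eq0 D0 eqxx.
  exists u, v, w; split=> //; rewrite -eK.
  have inD y : y \in K :\ u -> y = v \/ y = w.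
    by rewrite eK !inE => /andP[/negbTE->] /orP[] /eqP->; auto.
  (* The 3-cycle as a structure of type (3): the only edge away from [u] is [v w], of color
     [f v]. *)
  apply: (@layered_center _ _ _ _ u (f v)) => //.
  - move=> y z /inD[]-> /inD[]-> //; rewrite cuv cuw => /inj e; case/eqP: nuw;
      by rewrite e.
  - move=> y z /inD[]-> /inD[]->; rewrite ?eqxx // => _.
    by rewrite (out_col_sym outG wK vK) // eq_sym.
  - by move=> y /inD[]->; rewrite ?cuv ?cuw fne // eq_sym.
have K'm : #|K :\: [set u; v; w]| < m.
  apply: leq_trans (_ : #|K| <= m); last by rewrite -ltnS.
  apply: proper_card; apply/properP; split; first exact: subsetDl.
  by exists u; rewrite // !inE eqxx.
have [a [b [c [rb' ly]]]] := IH _ K'm K'0 (out_coloring_setD outG TK dom).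
exists a, b, c; split=> //; apply: (layered_triangle cK uK vK wK rb _ ly) => y yD.
have d x : x \in [set u; v; w] -> col G x y = f x.
  by move=> xT; case/andP: (dom y x yD xT) => _ /eqP.
by rewrite !d ?cuv ?cvw ?cuw // !inE eqxx ?orbT.
Qed.

End Layers.

(** * Averaging the losses, and the induction *)

Section Extremal.
Variables (V : finType) (C : eqType).
Implicit Types (G : ecgraph V C) (K : {set V}).

(** After exchanging the sums, each [u] contributes its number of colors used on exactly one
    edge. *)
Lemma sum_unique_at_le G :
  \sum_v \sum_u unique_at G u v <= \sum_u color_degree G u ?= iff
    [forall u, #|[set w in nbhd G u | unique_color (col G u) (nbhd G u) w]|
                 == color_degree G u].
Proof.
rewrite exchange_big /=; apply: leqif_sum => u _.
rewrite -big_mkcond sum1_card; split.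
  rewrite color_degreeE; apply: leq_trans (unique_colors_le _ _).
  by apply: subset_leq_card; apply/subsetP=> w; rewrite !inE.
by congr (_ == _); apply: eq_card => w; rewrite !inE.
Qed.

Lemma sum_loss_lt G x y : adj G x y -> ~~ unique_at G x y ->
  \sum_v \sum_u unique_at G u v < \sum_u color_degree G u.
Proof.
move=> xy nu; have [le eq] := sum_unique_at_le G; rewrite ltn_neqAle le andbT eq.
apply: contra nu => /forallP/(_ x)/eqP; rewrite color_degreeE => e.
by rewrite /unique_at xy (all_unique_colors (c := col G x) (A := nbhd G x)) ?e ?inE.
Qed.

Lemma supported_color_degree G K v :
  supported_on G K -> v \notin K -> color_degree G v = 0.
Proof.
move=> suppG vK; apply/eqP; rewrite -leqn0 (leq_trans (color_degree_le G v)) //.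
by rewrite (nbhd_out suppG).
Qed.

(** If all losses were at least [n + 1] for [n = #|K|], their sum would be at least
    [n (n + 1) >= 2 S]; but it is below [2 S], as some edge is not unique at an end. *)
Lemma exists_low_loss G K x y : supported_on G K -> adj G x y -> ~~ unique_at G x y ->
    2 * \sum_u color_degree G u <= #|K| * (#|K| + 1) ->
  exists2 v, v \in K & color_degree G v + \sum_u unique_at G u v <= #|K|.
Proof.
move=> suppG xy nu S_le; apply/exists_inP; apply: contraLR S_le => /exists_inPn high.
rewrite -ltnNge.
have : \sum_(v in K) (#|K| + 1) <= \sum_(v in K) (color_degree G v + \sum_u unique_at G u v).
  by apply: leq_sum => v vK; rewrite addn1 ltnNge high.
rewrite sum_nat_const => /leq_ltn_trans; apply.
have := sum_loss_lt xy nu; rewrite big_split /= mul2n -addnn.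
have le P (F : V -> nat) : \sum_(v in P : {set V}) F v <= \sum_v F v.
  by rewrite [X in _ <= X](bigID (mem P)) /= leq_addr.
have := le K (color_degree G); have := le K (fun v => \sum_u unique_at G u v).
lia.
Qed.

Theorem extremal_out_coloring G K :
    supported_on G K -> ~ has_properly_colored_C4 G ->
    #|K| * (#|K| + 1) <= 2 * \sum_v color_degree G v ->
  2 * \sum_v color_degree G v = #|K| * (#|K| + 1) /\ exists f, out_coloring G K f.
Proof.
(* Edge deletion keeps [K], so the measure also counts ordered adjacent pairs. *)
have [m] := ubnP (#|K| + #|[set p : V * V | adj G p.1 p.2]|).
elim: m G K => // m IH G K; rewrite ltnS => Gm suppG noC4 big.
have even_n : ~~ odd (#|K| * (#|K| + 1)) by rewrite oddM addn1 /= andbN.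
case: (boolP [exists p : V * V, adj G p.1 p.2 &&
    (#|K| * (#|K| + 1) <= 2 * \sum_v color_degree (del_edge G p.1 p.2) v)]).
  case/existsP=> -[x y] /= /andP[xy big'].
  have [||||_ [f [cK _ _ _]]] := IH (del_edge G x y) K.
  - apply: leq_trans (_ : _ < _) Gm; rewrite ltn_add2l; apply: proper_card; apply/properP; split.
      by apply/subsetP=> p; rewrite !inE => /andP[].
    by exists (x, y); rewrite !inE //= xy !eqxx.
  - by move=> a b /andP[ab _]; apply: suppG ab.
  - by move/restrict_C4.
  - exact: big'.
  have yx : adj G y x by rewrite adj_sym.
  have /andP[_] := cK x y (suppG _ _ xy) (suppG _ _ yx) (adj_neq xy).
  by rewrite /= !eqxx.
move/existsPn=> critical.
case: (boolP [exists p : V * V, adj G p.1 p.2 && ~~ unique_at G p.1 p.2]); last first.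
  move=> /existsPn proper.
  have properG u v : adj G u v -> unique_at G u v.
    by move=> uv; have := proper (u, v); rewrite /= uv negbK.
  case: (proper_order suppG properG noC4 big) => [/eqP K0 | [K3 S6]]; last first.
    by split; [rewrite S6 K3 | apply: (proper_triangle suppG)].
  rewrite cards_eq0 in K0; rewrite (eqP K0) cards0 big1 => [|v _].
    (* Any function serves on the empty [K]; [col G u u] supplies values in [C]. *)
    split=> //; exists (fun u => col G u u).
    by split=> [a b | a b | a b | a]; rewrite inE.
  by apply: (supported_color_degree suppG); rewrite (eqP K0) inE.
case/existsP=> -[x y] /= /andP[xy nu].
(* Deleting [x y] lowers [2 S] by at most 2 and brings it below the even number [n (n + 1)]. *)
have S_eq : 2 * \sum_v color_degree G v = #|K| * (#|K| + 1).
  have := sum_color_degree_del_edge xy nu; have := critical (x, y); rewrite /= xy /=.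
  move: big even_n; move: (#|K| * _) (\sum_v _) (\sum_v _) => N S S'; lia.
split=> //; have [|v vK low] := exists_low_loss suppG xy nu; first by rewrite S_eq.
have SE := sum_color_degree_del_vertex G v; have KE := cardsD1 v K; rewrite vK in KE.
have [||||S'_eq [f [h1 h2 h3 h4]]] := IH (del_vertex G v) (K :\ v).
- apply: leq_trans (_ : _ < _) Gm; rewrite KE -addnA ltnS leq_add2l.
  by apply/subset_leq_card/subsetP=> p; rewrite !inE => /andP[].
- by move=> a b /and3P[ab av _]; rewrite !inE av (suppG _ _ ab).
- by move/restrict_C4.
(* A loss at most [n] leaves twice the sum at least [n (n + 1) - 2 n = (n - 1) n]. *)
- by move: S_eq low SE KE; nia.
apply: (extend_out_coloring (v := v) (f := f)) => //.
- by split=> // a b aK bK ab; have /andP[] := h1 a b aK bK ab.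
(* Equality before and after the deletion makes the loss exactly [n]. *)
- by move: S_eq S'_eq SE KE; nia.
Qed.

End Extremal.

Theorem theorem7 (V : finType) (C : eqType) (G : ecgraph V C) (n : nat)
    (order_G : #|V| = n) (n_ge4 : 4 <= n) :
  ((n * (n + 1)) %/ 2 + 1 <= \sum_(v : V) color_degree G v ->
     has_properly_colored_C4 G)
  /\
  (\sum_(v : V) color_degree G v = (n * (n + 1)) %/ 2 ->
   ~ has_properly_colored_C4 G ->
     complete_on G [set: V] /\
     exists u v w : V,
       rainbow_triangle G u v w /\ layered G [set: V] [set u; v; w]).
Proof.
have twice : 2 * ((n * (n + 1)) %/ 2) = n * (n + 1).
  by rewrite mulnC divnK // dvdn2 oddM addn1 /= andbN.
have suppG : supported_on G [set: V] by move=> a b _; rewrite inE.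
have extr := extremal_out_coloring suppG; rewrite cardsT order_G in extr.
split=> [big | S_eq noC4].
  case: (C4_decidable G) => // noC4.
  by have [| S_eq _] := extr noC4; move: twice big; lia.
have [| _ [f outG]] := extr noC4; first by rewrite S_eq twice.
split; first by case: outG.
apply: (layered_out_coloring noC4 _ outG).
by rewrite -card_gt0 cardsT order_G; apply: leq_trans n_ge4.
Qed.
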